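(* Let $G_1,G_2,G_k$ be generators over $\Sigma_1,\Sigma_2,\Sigma_k$, respectively, with $\Sigma_1\cap\Sigma_2\subseteq\Sigma_k\subseteq\Sigma_1\cup\Sigma_2$, and put $L=L(G_1\| G_2\| G_k)$. Let $K\subseteq L_m(G_1\| G_2\| G_k)$ be a specification such that both $K$ and its prefix closure $\overline{K}$ are conditionally decomposable with respect to $\Sigma_1,\Sigma_2,\Sigma_k$. Define \[ \sup C_k=\sup C(P_k(K),L(G_k),\Sigma_{k,u}),\qquad \sup C_{i+k}=\sup C\big(P_{i+k}(K),\,L(G_i)\parallel\overline{\sup C_k},\,\Sigma_{i+k,u}\big),\quad i=1,2. \] Assume that $\sup C_{1+k}$ and $\sup C_{2+k}$ are nonconflicting. If $P^{1+k}_k(\sup C_{1+k})\cap P^{2+k}_k(\sup C_{2+k})$ is controllable with respect to $L(G_k)$ and $\Sigma_{k,u}$, then \[ \sup C_{1+k}\parallel\sup C_{2+k}=\sup cC\big(K,L,(\Sigma_{1,u},\Sigma_{2,u},\Sigma_{k,u})\big). \]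
   Context: An event set is a finite nonempty set $\Sigma$; a language over $\Sigma$ is a subset of the set $\Sigma^*$ of finite words, and the specification $K$ is a regular language. $\overline{L}$ denotes the prefix closure of $L$. A generator over $\Sigma$ is $G=(Q,\Sigma,f,q_0,Q_m)$ with finite nonempty state set $Q$, partial transition function $f:Q\times\Sigma\to Q$ (extended to words), initial state $q_0$, marked states $Q_m\subseteq Q$; $L(G)=\{s\in\Sigma^*: f(q_0,s)\text{ is defined}\}$ and $L_m(G)=\{s\in\Sigma^*: f(q_0,s)\in Q_m\}$. For $\Sigma_0\subseteq\Sigma$, the projection $\Sigma^*\to\Sigma_0^*$ is the homomorphism erasing events outside $\Sigma_0$ and fixing those in $\Sigma_0$. For $L_i\subseteq\Sigma_i^*$, $L_1\parallel L_2=\{w\in(\Sigma_1\cup\Sigma_2)^*: P_i(w)\in L_i,\ i=1,2\}$, where $P_i$ is the projection to $\Sigma_i^*$. $G_1\|G_2$ is the parallel composition of generators, with $L(G_1\|G_2)=L(G_1)\parallel L(G_2)$ and $L_m(G_1\|G_2)=L_m(G_1)\parallel L_m(G_2)$. Languages $L_1,L_2$ are nonconflicting if $\overline{L_1\parallel L_2}=\overline{L_1}\parallel\overline{L_2}$. The set $\Sigma_1\cup\Sigma_2$ is partitioned into controllable events $\Sigma_c$ and uncontrollable events $\Sigma_u$. Notation, for $i=1,2$: $\Sigma_{i+k}=\Sigma_i\cup\Sigma_k$; $\Sigma_{j,u}=\Sigma_j\cap\Sigma_u$ for $j\in\{1,2,k,1+k,2+k\}$; $P_k:(\Sigma_1\cup\Sigma_2)^*\to\Sigma_k^*$,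 $P_{i+k}:(\Sigma_1\cup\Sigma_2)^*\to\Sigma_{i+k}^*$ and $P^{i+k}_k:\Sigma_{i+k}^*\to\Sigma_k^*$ are projections. A language $K\subseteq(\Sigma_1\cup\Sigma_2)^*$ is conditionally decomposable with respect to $\Sigma_1,\Sigma_2,\Sigma_k$ if $K=P_{1+k}(K)\parallel P_{2+k}(K)$. A language $M$ is controllable with respect to a prefix-closed language $L$ and a set of uncontrollable events $\Sigma'_u$ if $\overline{M}\Sigma'_u\cap L\subseteq\overline{M}$. $\sup C(K,L,\Sigma'_u)$ denotes the supremal controllable sublanguage of $K$: the union (which is itself controllable) of all $M\subseteq K\cap L$ controllable with respect to $L$ and $\Sigma'_u$. A language $M\subseteq L_m(G_1\|G_2\|G_k)$ is conditionally controllable with respect to $G_1,G_2,G_k$ and $\Sigma_{1,u},\Sigma_{2,u},\Sigma_{k,u}$ if (1) $P_k(M)$ is controllable with respect to $L(G_k)$ and $\Sigma_{k,u}$; (2) for $i=1,2$, $P_{i+k}(M)$ is controllable with respect to $L(G_i)\parallel\overline{P_k(M)}$ and $\Sigma_{i+k,u}$. $\sup cC(K,L,(\Sigma_{1,u},\Sigma_{2,u},\Sigma_{k,u}))$ is the supremal conditionally controllable sublanguage of $K$, i.e. the union (which is itself conditionally controllable) of all conditionally controllable $M\subseteq K$. *)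

(* Defs.v *)
(* MathComp, with sets of words taken from mathcomp.classical.classical_sets. *)
From HB Require Import structures.
From mathcomp Require Import all_boot.
From mathcomp Require Import classical_sets.

Set Implicit Arguments.
Unset Strict Implicit.
Unset Printing Implicit Defensive.

Local Open Scope classical_set_scope.

(* All event sets are subsets of one ambient finite type E; a language over
   the event set A is a set of words over E contained in [words A].
   Operations depending on event sets take them as explicit arguments. *)

Definition words (E : finType) (A : {set E}) : set (seq E) :=
  [set w | all [in A] w].

(* The projection onto A; the same function serves for every domain B^* with
   A a subset of B. *)
Definition proj (E : finType) (A : {set E}) (w : seq E) : seq E :=
  [seq e <- w | e \in A].

Definition prefix_closure (E : finType) (L : set (seq E)) : set (seq E) :=
  [set s | exists t, L (s ++ t)].

Definition parallel (E : finType) (A1 : {set E}) (L1 : set (seq E))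
    (A2 : {set E}) (L2 : set (seq E)) : set (seq E) :=
  [set w | [/\ words (A1 :|: A2) w, L1 (proj A1 w) & L2 (proj A2 w)]].

(* [trans_out] makes [trans] a partial function on state * A. *)
Record generator (E : finType) (A : {set E}) := Generator {
  state : finType;
  trans : state -> E -> option state;
  trans_out : forall q e, e \notin A -> trans q e = None;
  init : state;
  marked : {set state}
}.

Section Generator.
Variables (E : finType) (A : {set E}) (G : generator A).

Fixpoint run (q : state G) (w : seq E) : option (state G) :=
  if w is e :: w' then obind (run^~ w') (trans q e) else Some q.

Definition gen_lang : set (seq E) := [set w | run (init G) w].

Definition marked_lang : set (seq E) :=
  [set w | exists2 q, run (init G) w = Some q & q \in marked G].

End Generator.

Section ParallelComposition.
Variables (E : finType) (A1 A2 : {set E}).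
Variables (G1 : generator A1) (G2 : generator A2).

Definition par_trans (q : state G1 * state G2) (e : E) :
    option (state G1 * state G2) :=
  if e \in A1 then
    if e \in A2 then
      if (trans q.1 e, trans q.2 e) is (Some q1, Some q2)
      then Some (q1, q2) else None
    else omap (fun q1 => (q1, q.2)) (trans q.1 e)
  else omap (fun q2 => (q.1, q2)) (trans q.2 e).

Lemma par_trans_out q e : e \notin A1 :|: A2 -> par_trans q e = None.
Proof.
rewrite /par_trans finset.in_setU negb_or => /andP[/negbTE-> A2e].
by rewrite trans_out.
Qed.

Definition par_gen : generator (A1 :|: A2) :=
  @Generator E (A1 :|: A2) (state G1 * state G2)%type par_trans par_trans_out
    (init G1, init G2) (finset.setX (marked G1) (marked G2)).

Lemma run_par (q : state par_gen) w :
  run q w = if all [in A1 :|: A2] w then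
    if (run q.1 (proj A1 w), run q.2 (proj A2 w)) is (Some q1, Some q2)
    then Some (q1, q2) else None else None.
Proof.
elim: w q => [|e w IH] [q1 q2] //=; rewrite /par_trans finset.in_setU /=.
case A1e: (e \in A1); case A2e: (e \in A2) => /=.
- case: (trans q1 e) => [r1|] /=; last by case: all.
  case: (trans q2 e) => [r2|] /=; first by rewrite IH.
  by case: all => //; case: run.
- by case: (trans q1 e) => [r1|] /=; [rewrite IH | case: all].
- case: (trans q2 e) => [r2|] /=; first by rewrite IH.
  by case: all => //; case: run.
- by rewrite trans_out ?A2e.
Qed.

Lemma gen_lang_par :
  gen_lang par_gen = parallel A1 (gen_lang G1) A2 (gen_lang G2).
Proof.
apply/seteqP; split=> w; rewrite /gen_lang /parallel /words /= run_par.
- by case: all => //; case: run => // q1; case: run.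
- by case=> ->; case: run => // q1 _; case: run.
Qed.

Lemma marked_lang_par :
  marked_lang par_gen = parallel A1 (marked_lang G1) A2 (marked_lang G2).
Proof.
apply/seteqP; split=> w; rewrite /marked_lang /parallel /words /=.
- case=> q; rewrite run_par; case: all => //.
  case: run => // q1; case: run => // q2 [<-].
  rewrite finset.in_setX => /andP[m1 m2].
  by split=> //; [exists q1 | exists q2].
- case=> Aw [q1 r1 m1] [q2 r2 m2]; exists (q1, q2).
    by rewrite run_par Aw /= r1 r2.
  by rewrite finset.in_setX m1.
Qed.

End ParallelComposition.

Definition regular (E : finType) (A : {set E}) (L : set (seq E)) : Prop :=
  exists G : generator A, marked_lang G = L.

Definition nonconflicting (E : finType) (A1 : {set E}) (L1 : set (seq E))
    (A2 : {set E}) (L2 : set (seq E)) : Prop :=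
  prefix_closure (parallel A1 L1 A2 L2) =
  parallel A1 (prefix_closure L1) A2 (prefix_closure L2).

Definition cond_decomposable (E : finType) (A1 A2 Ak : {set E})
    (K : set (seq E)) : Prop :=
  K = parallel (A1 :|: Ak) (proj (A1 :|: Ak) @` K)
               (A2 :|: Ak) (proj (A2 :|: Ak) @` K).

Definition controllable (E : finType) (M L : set (seq E)) (U : {set E}) :
    Prop :=
  forall s u, prefix_closure M s -> u \in U -> L (rcons s u) ->
    prefix_closure M (rcons s u).

Definition supC (E : finType) (K L : set (seq E)) (U : {set E}) :
    set (seq E) :=
  \bigcup_(M in [set M | M `<=` K `&` L /\ controllable M L U]) M.

Section ConditionalControllability.
Variables (E : finType) (A1 A2 Ak : {set E}).
Variables (G1 : generator A1) (G2 : generator A2) (Gk : generator Ak).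

(* U is the set of all uncontrollable events; the uncontrollable events of an
   event set A are A :&: U. *)
Definition cond_controllable (U : {set E}) (M : set (seq E)) : Prop :=
  let PkM := proj Ak @` M in
  let P1kM := proj (A1 :|: Ak) @` M in
  let P2kM := proj (A2 :|: Ak) @` M in
  [/\ M `<=` marked_lang (par_gen (par_gen G1 G2) Gk),
      controllable PkM (gen_lang Gk) (Ak :&: U),
      controllable P1kM
        (parallel A1 (gen_lang G1) Ak (prefix_closure PkM))
        ((A1 :|: Ak) :&: U)
    & controllable P2kM
        (parallel A2 (gen_lang G2) Ak (prefix_closure PkM))
        ((A2 :|: Ak) :&: U)].

Definition supcC (K : set (seq E)) (U : {set E}) : set (seq E) :=
  \bigcup_(M in [set M | M `<=` K /\ cond_controllable U M]) M.

End ConditionalControllability.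

(* Main.v *)
Require Import Defs.
From HB Require Import structures.
From mathcomp Require Import all_boot.
From mathcomp Require Import classical_sets.

(** Write [Mi] for supC_(i+k) and [M] for the parallel composition of [M1] and
    [M2].  The two event sets S1 :|: Sk and S2 :|: Sk share exactly Sk, so a
    word of [M1] and a word of [M2] with the same projection onto Sk are the
    projections of a common word ([proj_sync]).

    The supremal sublanguage contains [M].  Conditional decomposability gives
    [M `<=` K].  By synchronisation the projection of [M] onto Sk is the
    intersection of those of [M1] and [M2], which is controllable by
    hypothesis.  For the projection of [M] onto Si :|: Sk, an uncontrollable
    extension is first absorbed by the prefix closure of [Mi], as [Mi] is
    controllable for a larger plant; it is then synchronised with a prefix of
    the other language, and nonconflictingness says that the resulting word is
    a prefix of [M] ([controllable_proj_parallel]).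

    Conversely, let [N `<=` K] be conditionally controllable.  Its projection
    onto Sk is among the languages whose union is supC_k.  Its projection onto
    Si :|: Sk is controllable for a plant in which Sk is restricted to the
    projection of [N]; since that projection is itself controllable, the
    restriction can be relaxed to supC_k ([controllable_parallel_trans]), so
    that the projection of [N] lies in [Mi].  Hence [N `<=` M]. *)

Set Implicit Arguments.
Unset Strict Implicit.
Unset Printing Implicit Defensive.

Local Open Scope classical_set_scope.

(** * Projections and synchronisation of words *)

Section Words.
Variable E : finType.
Implicit Types (A B : {set E}) (L M : set (seq E)) (s t w : seq E).

Lemma words_proj A w : words A (proj A w).
Proof. exact: filter_all. Qed.

Lemma words_sub A B w : A \subset B -> words A w -> words B w.
Proof. by move=> /fintype.subsetP AB; apply: sub_all. Qed.

Lemma words_prefix A L s : L `<=` words A -> prefix_closure L s -> words A s.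
Proof. by move=> LA [t /LA]; rewrite /words /= all_cat => /andP[]. Qed.

Lemma proj_words A w : words A w -> proj A w = w.
Proof. by move/all_filterP. Qed.

Lemma proj_proj A B w : proj A (proj B w) = proj (A :&: B) w.
Proof.
rewrite /proj -filter_predI; apply: eq_filter => e.
by rewrite /= finset.in_setI.
Qed.

Lemma proj_proj_sub A B w : A \subset B -> proj A (proj B w) = proj A w.
Proof. by move=> /finset.setIidPl AB; rewrite proj_proj AB. Qed.

Lemma proj_rcons A w e :
  proj A (rcons w e) = if e \in A then rcons (proj A w) e else proj A w.
Proof. exact: filter_rcons. Qed.

(** If the two heads are shared events they coincide and are produced once;
    otherwise some head is private to its word and can be produced alone. *)
Lemma proj_sync A1 A2 w1 w2 :
  words A1 w1 -> words A2 w2 -> proj A2 w1 = proj A1 w2 ->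
  exists w, [/\ words (A1 :|: A2) w, proj A1 w = w1 & proj A2 w = w2].
Proof.
elim: w1 w2 => [|a w1 IH1] w2 A1w1 A2w2 eqw.
  exists w2; split; last exact: proj_words.
    exact: words_sub (finset.subsetUr _ _) A2w2.
  by rewrite -eqw.
case/andP: (A1w1) => A1a A1w1'.
case A2a: (a \in A2); last first.
  have [|w [Aw p1 p2]] := IH1 w2 A1w1' A2w2.
    by move: eqw; rewrite /= A2a.
  exists (a :: w); rewrite /words /= finset.in_setU A1a A2a.
  by split=> //; rewrite p1.
elim: w2 A2w2 eqw => [|b w2 IH2] A2w2 /=; first by rewrite A2a.
case/andP: A2w2 => A2b A2w2; rewrite A2a.
case A1b: (b \in A1) => eqw.
  case: eqw => <- /(IH1 _ A1w1' A2w2)[w [Aw p1 p2]].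
  exists (a :: w); rewrite /words /= finset.in_setU A1a A2a.
  by split=> //; rewrite ?p1 ?p2.
have [|w [Aw p1 p2]] := IH2 A2w2; first by rewrite /= A2a.
exists (b :: w); rewrite /words /= finset.in_setU A1b A2b.
by split=> //; rewrite p2.
Qed.

(** * Prefix closures, projections of languages and controllability *)

Lemma prefix_closure_sub L M :
  L `<=` M -> prefix_closure L `<=` prefix_closure M.
Proof. by move=> LM s [t /LM Mst]; exists t. Qed.

Lemma sub_prefix_closure L : L `<=` prefix_closure L.
Proof. by move=> s Ls; exists [::]; rewrite cats0. Qed.

Lemma prefix_closure_idem L :
  prefix_closure (prefix_closure L) = prefix_closure L.
Proof.
apply/seteqP; split=> [s [t [t' Lst]]|]; last exact: sub_prefix_closure.
by exists (t ++ t'); rewrite catA.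
Qed.

Lemma proj_eq_cat A w s t : proj A w = s ++ t ->
  exists w1 w2, w = w1 ++ w2 /\ proj A w1 = s.
Proof.
elim: w s => [|e w IH] s /=.
  by case: s => // _; exists [::], [::].
case: s => [|a s]; first by exists [::], (e :: w).
case Ae: (e \in A).
  case=> <- /IH[w1 [w2 [-> <-]]].
  by exists (e :: w1), w2; rewrite /= Ae.
move=> /IH[w1 [w2 [-> <-]]].
by exists (e :: w1), w2; rewrite /= Ae.
Qed.

Lemma prefix_closure_proj A L :
  prefix_closure (proj A @` L) = proj A @` prefix_closure L.
Proof.
apply/seteqP; split=> [s [t [w Lw /proj_eq_cat[w1 [w2 [ew <-]]]]]|].
  by exists w1 => //; exists w2; rewrite -ew.
move=> _ [w [t Lwt] <-]; exists (proj A t), (w ++ t) => //.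
exact: filter_cat.
Qed.

Lemma image_proj_proj A B L :
  A \subset B -> proj A @` (proj B @` L) = proj A @` L.
Proof.
by move=> AB; rewrite image_comp; apply: eq_imagel => w _; apply: proj_proj_sub.
Qed.

Lemma parallelC A1 A2 L1 L2 : parallel A1 L1 A2 L2 = parallel A2 L2 A1 L1.
Proof.
by apply/seteqP; split=> w [Aw L1w L2w]; split=> //; rewrite finset.setUC.
Qed.

Lemma proj_parallel A1 A2 Ak L1 L2 :
    A1 :&: A2 = Ak -> L1 `<=` words A1 -> L2 `<=` words A2 ->
  proj Ak @` parallel A1 L1 A2 L2 = (proj Ak @` L1) `&` (proj Ak @` L2).
Proof.
move=> <- LA1 LA2.
have [I1 I2] := (finset.subsetIl A1 A2, finset.subsetIr A1 A2).
apply/seteqP; split=> [_ [w [Aw L1w L2w] <-]|s [[w1 L1w <-] [w2 L2w eqw]]].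
  by split; [exists (proj A1 w) | exists (proj A2 w)] => //;
    rewrite proj_proj_sub.
have [A1w A2w] := (LA1 _ L1w, LA2 _ L2w).
have [|w [Aw p1 p2]] := proj_sync A1w A2w.
  rewrite -{1}(proj_words A1w) -{1}(proj_words A2w) !proj_proj.
  by rewrite finset.setIC.
by exists w; [split; rewrite ?p1 ?p2 | rewrite -p1 proj_proj_sub].
Qed.

Lemma supC_sub K L U : supC K L U `<=` K `&` L.
Proof. by move=> w [M [MKL _] /MKL]. Qed.

Lemma supC_controllable K L U : controllable (supC K L U) L U.
Proof.
move=> s u [t [M [MKL Mc] Mst]] Uu Lsu.
have [t' Msut] := Mc s u (ex_intro _ t Mst) Uu Lsu.
by exists t', M.
Qed.

Lemma sub_supC K L U M :
  M `<=` K -> M `<=` L -> controllable M L U -> M `<=` supC K L U.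
Proof.
by move=> MK ML Mc w Mw; exists M => //; split=> // v Mv; split; auto.
Qed.

(** The bound on the prefixes of [proj Ak @` M1] makes the plant of the
    conclusion smaller than the one for which [M1] is controllable.  An
    extension accepted by it is thus a prefix of [M1], and its projection onto
    the shared events is also that of a prefix of [M2]; nonconflictingness turns
    the common word into a prefix of the composition. *)
Lemma controllable_proj_parallel A1 A2 S Ak L D M1 M2 U :
    A1 :&: A2 = Ak -> M1 `<=` words A1 -> M2 `<=` words A2 ->
    prefix_closure (proj Ak @` M1) `<=` D ->
    controllable M1 (parallel S L Ak D) U ->
    nonconflicting A1 M1 A2 M2 ->
  let M := parallel A1 M1 A2 M2 in
  controllable (proj A1 @` M)
    (parallel S L Ak (prefix_closure (proj Ak @` M))) U.
Proof.
move=> A12 MA1 MA2 M1D M1c nc M s u Ms Uu [Ssu Lsu Dsu].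
have MM1 : proj A1 @` M `<=` M1 by move=> _ [w [] // _ ? ? <-].
have PM : proj Ak @` M = (proj Ak @` M1) `&` (proj Ak @` M2).
  exact: proj_parallel.
have M1su : prefix_closure M1 (rcons s u).
  apply: M1c => //; first exact: prefix_closure_sub Ms.
  split=> //; apply/M1D; apply: prefix_closure_sub Dsu.
  by rewrite PM => w [].
have [v M2v eqv] : (proj Ak @` prefix_closure M2) (proj Ak (rcons s u)).
  rewrite -prefix_closure_proj; apply: prefix_closure_sub Dsu.
  by rewrite PM => w [].
have [A1su A2v] := (words_prefix MA1 M1su, words_prefix MA2 M2v).
have [|w [Aw p1 p2]] := proj_sync A1su A2v.
  rewrite -{1}(proj_words A1su) -{1}(proj_words A2v) !proj_proj.
  by rewrite [A2 :&: A1]finset.setIC A12.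
rewrite prefix_closure_proj; exists w => //.
by rewrite /M nc; split; rewrite ?p1 ?p2.
Qed.

(** After an uncontrollable event of [Ak] admitted by [D], the projection onto
    [Ak] is still a prefix of [proj Ak @` M], because that language is
    controllable for the larger [Lk]; any other event leaves the projection
    unchanged.  So restricting the plant to [proj Ak @` M] excludes no
    uncontrollable extension that [D] admits. *)
Lemma controllable_parallel_trans A S Ak L Lk D M U :
    controllable (proj Ak @` M) Lk (Ak :&: U) -> D `<=` Lk ->
    controllable M (parallel S L Ak (prefix_closure (proj Ak @` M)))
      (A :&: U) ->
  controllable M (parallel S L Ak D) (A :&: U).
Proof.
move=> PMc DLk Mc s u Ms AUu [Ssu Lsu Dsu]; apply: Mc => //; split=> //.
have PMs : prefix_closure (proj Ak @` M) (proj Ak s).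
  by rewrite prefix_closure_proj; exists s.
move: Dsu; rewrite proj_rcons; case: ifP => // Aku /DLk Lksu.
apply: PMc => //; rewrite finset.in_setI Aku.
by move: AUu; rewrite finset.in_setI => /andP[].
Qed.

Lemma prefix_closure_proj_supC S Ak K L D U :
  prefix_closure (proj Ak @` supC K (parallel S L Ak (prefix_closure D)) U)
    `<=` prefix_closure D.
Proof.
rewrite -[X in _ `<=` X]prefix_closure_idem; apply: prefix_closure_sub.
by move=> _ [w Cw <-]; case: (supC_sub Cw) => _ [].
Qed.

Lemma prefix_closure_gen_lang A (G : generator A) :
  prefix_closure (gen_lang G) `<=` gen_lang G.
Proof.
move=> s [t]; rewrite /gen_lang /=.
elim: s (init G) => [//|e s IH] q /=; case: trans => //= q'; exact: IH.
Qed.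

Lemma marked_lang_sub A (G : generator A) : marked_lang G `<=` gen_lang G.
Proof. by move=> w [q]; rewrite /gen_lang /= => ->. Qed.

End Words.

(** * The supremal conditionally controllable sublanguage *)

Section Supremal.
Variables (E : finType) (S1 S2 S Sk U : {set E}).

Lemma local_events_meet :
  S1 :&: S2 \subset Sk -> (S1 :|: Sk) :&: (S2 :|: Sk) = Sk.
Proof. by move=> S12; rewrite -finset.setUIl; apply/finset.setUidPr. Qed.

Lemma local_events_join : (S1 :|: Sk) :|: (S2 :|: Sk) = S1 :|: S2 :|: Sk.
Proof. by rewrite finset.setUACA finset.setUid. Qed.

Lemma marked_par_gen_sub
    (G1 : generator S1) (G2 : generator S2) (Gk : generator Sk) w :
  marked_lang (par_gen (par_gen G1 G2) Gk) w ->
  [/\ words (S1 :|: S2 :|: Sk) w, gen_lang G1 (proj S1 w),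
      gen_lang G2 (proj S2 w) & gen_lang Gk (proj Sk w)].
Proof.
rewrite !marked_lang_par => -[Aw [_ m1 m2] mk]; split=> //.
- by have := marked_lang_sub m1; rewrite proj_proj_sub ?finset.subsetUl.
- by have := marked_lang_sub m2; rewrite proj_proj_sub ?finset.subsetUr.
- exact: marked_lang_sub.
Qed.

(** The part of the second inclusion that concerns one component.  The plant of
    the hypothesis is cut down to [proj Sk @` M], which lies in supC_k because
    it is one of the languages whose union supC_k is; transitivity then gives
    controllability for the plant cut down to supC_k only. *)
Lemma proj_sub_supC
    (G : generator S) (Gk : generator Sk) (K M : set (seq E)) :
    let A := S :|: Sk in
    let Ck := supC (proj Sk @` K) (gen_lang Gk) (Sk :&: U) in
    M `<=` K ->
    (forall w, M w -> gen_lang G (proj S w) /\ gen_lang Gk (proj Sk w)) ->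
    controllable (proj Sk @` M) (gen_lang Gk) (Sk :&: U) ->
    controllable (proj A @` M)
      (parallel S (gen_lang G) Sk (prefix_closure (proj Sk @` M)))
      (A :&: U) ->
  proj A @` M `<=` supC (proj A @` K)
    (parallel S (gen_lang G) Sk (prefix_closure Ck)) (A :&: U).
Proof.
move=> A Ck MK Mgen PkMc PMc.
have SA : S \subset A := finset.subsetUl S Sk.
have SkA : Sk \subset A := finset.subsetUr S Sk.
have PkMCk : proj Sk @` M `<=` Ck.
  apply: sub_supC => // _ [w Mw <-]; last by case: (Mgen w Mw).
  by exists w => //; apply: MK.
apply: sub_supC.
- exact: image_subset.
- move=> _ [w Mw <-]; split; first exact: words_proj.
    by rewrite proj_proj_sub //; case: (Mgen w Mw).
  by rewrite proj_proj_sub //; apply/sub_prefix_closure/PkMCk; exists w.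
- apply: (@controllable_parallel_trans _ _ _ _ _ (gen_lang Gk)).
  + by rewrite image_proj_proj.
  + apply: subset_trans (@prefix_closure_gen_lang _ _ Gk).
    by apply: prefix_closure_sub => w Cw; case: (supC_sub Cw).
  + by rewrite image_proj_proj.
Qed.

End Supremal.

Theorem theorem4 (E : finType) (S1 S2 Sk Sc Su : {set E})
    (S1_neq0 : S1 != finset.set0) (S2_neq0 : S2 != finset.set0)
    (Sk_neq0 : Sk != finset.set0)
    (S12_sub : S1 :&: S2 \subset Sk) (Sk_sub : Sk \subset S1 :|: S2)
    (Scu_cover : Sc :|: Su = S1 :|: S2) (Scu_disj : Sc :&: Su = finset.set0)
    (G1 : generator S1) (G2 : generator S2) (Gk : generator Sk)
    (K : set (seq E))
    (K_reg : regular (S1 :|: S2) K)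
    (K_sub : K `<=` marked_lang (par_gen (par_gen G1 G2) Gk))
    (K_dec : cond_decomposable S1 S2 Sk K)
    (Kbar_dec : cond_decomposable S1 S2 Sk (prefix_closure K)) :
  let S1k := S1 :|: Sk in
  let S2k := S2 :|: Sk in
  let supCk := supC (proj Sk @` K) (gen_lang Gk) (Sk :&: Su) in
  let supC1k := supC (proj S1k @` K)
    (parallel S1 (gen_lang G1) Sk (prefix_closure supCk)) (S1k :&: Su) in
  let supC2k := supC (proj S2k @` K)
    (parallel S2 (gen_lang G2) Sk (prefix_closure supCk)) (S2k :&: Su) in
  nonconflicting S1k supC1k S2k supC2k ->
  controllable ((proj Sk @` supC1k) `&` (proj Sk @` supC2k))
    (gen_lang Gk) (Sk :&: Su) ->
  parallel S1k supC1k S2k supC2k = supcC G1 G2 Gk K Su.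
Proof.
move=> S1k S2k supCk supC1k supC2k nc capC.
have meet : S1k :&: S2k = Sk := local_events_meet S12_sub.
have C1A : supC1k `<=` words S1k by move=> w Cw; case: (supC_sub Cw) => _ [].
have C2A : supC2k `<=` words S2k by move=> w Cw; case: (supC_sub Cw) => _ [].
apply/seteqP; split=> [|w [N [NK [_ PkNc P1N P2N]] Nw]].
  set M := parallel _ _ _ _.
  have MK : M `<=` K.
    move=> w [Aw C1w C2w]; rewrite K_dec; split=> //.
      by case: (supC_sub C1w).
    by case: (supC_sub C2w).
  move=> w Mw; exists M => //; split=> //; split.
  - exact: subset_trans K_sub.
  - by rewrite /M (proj_parallel meet).
  - apply: (controllable_proj_parallel (D := prefix_closure supCk) meet) => //.
    + exact: prefix_closure_proj_supC.
    + exact: supC_controllable.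
  - rewrite /M parallelC.
    apply: (controllable_proj_parallel (D := prefix_closure supCk)) => //.
    + by rewrite finset.setIC.
    + exact: prefix_closure_proj_supC.
    + exact: supC_controllable.
    + by rewrite /nonconflicting parallelC nc parallelC.
have Ngen v : N v -> [/\ words (S1 :|: S2 :|: Sk) v, gen_lang G1 (proj S1 v),
    gen_lang G2 (proj S2 v) & gen_lang Gk (proj Sk v)].
  by move=> /NK/K_sub/marked_par_gen_sub.
split.
- by rewrite local_events_join; case: (Ngen w Nw).
- apply: (proj_sub_supC NK) P1N _ _ => //; last by exists w.
  by move=> v /Ngen[].
- apply: (proj_sub_supC NK) P2N _ _ => //; last by exists w.
  by move=> v /Ngen[].
Qed.
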